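(* Let $\mathbb{F}_2$ be the free group with two generators, with a fixed finite symmetric generating set $F$ containing the identity, and let $\omega_\beta(x)=(1+\tau(x))^\beta$ $(x\in\mathbb{F}_2)$, where $\tau=\tau_F$ is the length function. Then $\ell^1(\mathbb{F}_2,\omega_\beta)$ is not an injective algebra for any $\beta>0$.
   Context: For a finite symmetric generating set $F$ containing the identity $e$ of a group, $F^n=\{u_1\cdots u_n: u_i\in F\}$ and the length function is $\tau_F(x)=\inf\{n\ge 1: x\in F^n\}$ for $x\ne e$, $\tau_F(e)=0$ (for $\mathbb{F}_2$ with free generators $g_1,g_2$ and $F=\{e,g_1^{\pm1},g_2^{\pm1}\}$ this is the usual word length). For a weight $\omega$ on a discrete group $G$ (a function $\omega:G\to(0,\infty)$ with $\omega(xy)\le\omega(x)\omega(y)$), $\ell^1(G,\omega)$ is the convolution algebra of functions $g:G\to\mathbb{C}$ with $\|g\|=\sum_{x\in G}|g(x)|\omega(x)<\infty$. A Banach algebra $\mathcal{A}$ is an injective algebra if its multiplication extends to a bounded linear map $\mathcal{A}\otimes_\varepsilon\mathcal{A}\to\mathcal{A}$ on the injective Banach space tensor product. *)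

(* Defs.v *)
From HB Require Import structures.
From mathcomp Require Import all_boot all_order all_algebra finmap complex.
From mathcomp Require Import all_classical all_reals all_analysis.
From mathcomp Require summability.
From mathcomp Require Import lra.

Set Implicit Arguments.
Unset Strict Implicit.
Unset Printing Implicit Defensive.

Import Order.TTheory GRing.Theory Num.Theory numFieldNormedType.Exports.
Import ComplexField.Normc.

Local Open Scope classical_set_scope.
Local Open Scope complex_scope.
Local Open Scope ring_scope.

Section free_group.
Variable I : choiceType.

(* The letter (i, false) is the generator g_i and (i, true) is its inverse. *)
Definition letter : Type := (I * bool)%type.

Definition flip (a : letter) : letter := (a.1, ~~ a.2).

Definition reduced (s : seq letter) : bool :=
  sorted (fun a b => b != flip a) s.

Record free_group := FreeWord { word :> seq letter; _ : reduced word }.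

HB.instance Definition _ := [isSub for word].
HB.instance Definition _ := [Choice of free_group by <:].

(* Reduced form of the word [a :: s], for [s] reduced. *)
Definition push (a : letter) (s : seq letter) : seq letter :=
  if s is b :: s' then if b == flip a then s' else a :: s else [:: a].

Definition catw (s t : seq letter) : seq letter := foldr push t s.
Definition invw (s : seq letter) : seq letter := rev (map flip s).

Lemma flipK : involutive flip.
Proof. by case=> i b; rewrite /flip /= negbK. Qed.

Lemma push_reduced a s : reduced s -> reduced (push a s).
Proof.
case: s => [//|b s] /= rs; case: ifPn => [_|nab]; first exact: path_sorted rs.
by rewrite /reduced /= nab.
Qed.

Lemma catw_reduced s t : reduced t -> reduced (catw s t).
Proof. by move=> rt; elim: s => //= a s; exact: push_reduced. Qed.

Lemma invw_reduced s : reduced s -> reduced (invw s).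
Proof.
rewrite /reduced /invw rev_sorted sorted_map; case: s => //= a s.
apply: sub_path => x y /= nyx; rewrite flipK.
by apply: contra nyx => /eqP ->.
Qed.

Lemma pushK a s : reduced s -> push a (push (flip a) s) = s.
Proof.
case: s => [|b s] /=; first by rewrite eqxx.
rewrite flipK; case: eqP => [->|_ _] /=; last by rewrite eqxx.
by case: s => [//|c s] /= /andP[/negPf -> _].
Qed.

Lemma catwA s t u : reduced u -> catw s (catw t u) = catw (catw s t) u.
Proof.
move=> ru; elim: s => //= a s ->.
case: (catw s t) => [//|b w] /=; case: eqP => [->|//] /=.
by rewrite pushK// catw_reduced.
Qed.

Lemma catws0 s : reduced s -> catw s [::] = s.
Proof.
elim: s => //= a s IH rs; rewrite IH; last exact: path_sorted rs.
by case: s rs {IH} => [//|b s] /= /andP[/negPf -> _].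
Qed.

Lemma catVw s : catw (invw s) s = [::].
Proof.
elim: s => //= a s IH; rewrite /invw /= rev_cons /catw foldr_rcons /=.
by rewrite flipK eqxx.
Qed.

Definition fg_one : free_group := @FreeWord [::] isT.
Definition fg_mul (x y : free_group) : free_group :=
  FreeWord (catw_reduced x (valP y)).
Definition fg_inv (x : free_group) : free_group :=
  FreeWord (invw_reduced (valP x)).

Lemma fg_mulA : associative fg_mul.
Proof. by move=> x y z; apply/val_inj; exact/catwA/valP. Qed.

Lemma fg_mul1 : left_id fg_one fg_mul.
Proof. by move=> x; exact/val_inj. Qed.

Lemma fg_mulr1 : right_id fg_one fg_mul.
Proof. by move=> x; apply/val_inj; exact/catws0/valP. Qed.

Lemma fg_mulV : left_inverse fg_one fg_inv fg_mul.
Proof. by move=> x; apply/val_inj; exact: catVw. Qed.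

Lemma fg_mulrV : right_inverse fg_one fg_inv fg_mul.
Proof.
move=> x; rewrite -[X in fg_mul X _](_ : fg_inv (fg_inv x) = x) ?fg_mulV//.
by apply/val_inj; rewrite /= /invw map_rev revK -map_comp map_id_in// => a _;
  exact: flipK.
Qed.

HB.instance Definition _ :=
  isGroup.Build free_group fg_mulA fg_mul1 fg_mulr1 fg_mulV fg_mulrV.

End free_group.

Definition F2 : groupType := free_group 'I_2.

Section length_function.
Variable G : groupType.
Local Open Scope group_scope.

(* No proper subgroup of [G] contains [F]. *)
Definition generates (F : {fset G}) : Prop :=
  forall H : {pred G}, group_closed H -> {subset F <= H} -> H =i predT.

Record symGenSet := SymGenSet {
  genset :> {fset G};
  genset1 : 1 \in genset;
  gensetV : forall x, x \in genset -> x^-1 \in genset;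
  genset_gen : generates genset }.

Definition setpow (F : {fset G}) (n : nat) : set G :=
  [set x | exists u : 'I_n -> G,
     (forall i, u i \in F) /\ x = \prod_(i < n) u i].

Lemma setpowP (F : {fset G}) n x : setpow F n x <->
  exists s : seq G, [/\ size s = n, {subset s <= F} & x = \prod_(y <- s) y].
Proof.
split=> [[u [uF ->]]|[s [<- sF ->]]].
  exists [seq u i | i <- enum 'I_n]; split.
  - by rewrite size_map size_enum_ord.
  - by move=> y /mapP[i _ ->].
  - by rewrite big_map [index_enum _]unlock enumT.
exists (fun i => tnth (in_tuple s) i); split.
  by move=> i; apply/sF/mem_tnth.
by rewrite (big_tnth _ _ s).
Qed.

Lemma setpowM (F : {fset G}) m n x y :
  setpow F m x -> setpow F n y -> setpow F (m + n) (x * y).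
Proof.
move=> /setpowP[s [<- sF ->]] /setpowP[t [<- tF ->]]; apply/setpowP.
exists (s ++ t); split; rewrite ?size_cat ?big_cat//.
by move=> z; rewrite mem_cat => /orP[/sF|/tF].
Qed.

Variable F : symGenSet.

Lemma setpow_gen x : exists n, (0 < n)%N && `[< setpow F n x >].
Proof.
pose H : {pred G} := [pred y | `[< exists2 n, (0 < n)%N & setpow F n y >]].
have FH y : y \in genset F -> y \in H.
  move=> yF; apply/asboolP; exists 1%N => //; apply/setpowP.
  by exists [:: y]; split=> // [z|]; rewrite ?big_seq1// inE => /eqP ->.
suff: x \in H.
  by move=> /asboolP[n n0 Fnx]; exists n; rewrite n0; exact/asboolP.
rewrite (@genset_gen F H)//; split; first exact/FH/genset1.
move=> y z /asboolP[m m0 Fy] /asboolP[n n0 Fz].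
apply/asboolP; exists (m + n)%N; first by rewrite addn_gt0 m0.
apply: setpowM => //; case/setpowP: Fz => s [sn sF ->]; apply/setpowP.
exists (rev [seq y^-1 | y <- s]); split.
- by rewrite size_rev size_map.
- by move=> t; rewrite mem_rev => /mapP[v /sF vF ->]; exact: gensetV.
- by rewrite -map_rev big_map prodgV revK.
Qed.

Definition tau (x : G) : nat := if x == 1 then 0%N else ex_minn (setpow_gen x).

Lemma tau1 : tau 1 = 0%N. Proof. by rewrite /tau eqxx. Qed.

Lemma tauM x y : (tau (x * y) <= tau x + tau y)%N.
Proof.
have [->|x1] := eqVneq x 1; first by rewrite mul1g tau1.
have [->|y1] := eqVneq y 1; first by rewrite mulg1 tau1 addn0.
rewrite /tau (negPf x1) (negPf y1); case: ifP => // _.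
case: ex_minnP => k _ kmin.
case: ex_minnP => m /andP[m0 /asboolP Fx] _.
case: ex_minnP => n /andP[n0 /asboolP Fy] _.
by apply: kmin; rewrite addn_gt0 m0; exact/asboolP/setpowM.
Qed.

End length_function.

Record weight (R : realType) (G : groupType) := Weight {
  wt :> G -> R;
  wt_gt0 : forall x, 0 < wt x;
  wtM : forall x y, wt (x * y)%g <= wt x * wt y }.

Section polynomial_weight.
Variables (R : realType) (G : groupType) (F : symGenSet G) (beta : R).
Hypothesis beta_ge0 : 0 <= beta.

Definition omega_fun (x : G) : R := (1 + (tau F x)%:R) `^ beta.

Lemma omega_gt0 x : 0 < omega_fun x.
Proof. by rewrite powR_gt0// ltr_pwDl. Qed.

Lemma omegaM x y : omega_fun (x * y)%g <= omega_fun x * omega_fun y.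
Proof.
rewrite -powRM ?addr_ge0// ge0_ler_powR ?nnegrE ?addr_ge0 ?mulr_ge0//.
have : ((tau F (x * y)%g)%:R : R) <= (tau F x)%:R + (tau F y)%:R.
  by rewrite -natrD ler_nat tauM.
have : 0 <= (tau F x)%:R * (tau F y)%:R :> R by rewrite mulr_ge0.
by nra.
Qed.

Definition omega : weight R G := Weight omega_gt0 omegaM.

End polynomial_weight.

Section esum_extra.
Variables (R : realType) (T : choiceType).
Implicit Types (a : T -> \bar R).
Local Open Scope ereal_scope.

Lemma esumZ (c : R) a : (0 <= c)%R -> (forall x, 0 <= a x) ->
  \esum_(x in [set: T]) (c%:E * a x) = c%:E * \esum_(x in [set: T]) a x.
Proof.
move=> c0 a0; rewrite /esum -ereal_supZl//; last first.
  by apply/set0P; exists (\sum_(x \in set0) a x), set0; first exact: fsets_set0.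
congr ereal_sup; rewrite image_comp; apply: eq_imagel => X _ /=.
by rewrite ge0_mule_fsumr.
Qed.

Lemma exchange_esum (S : choiceType) (a : T -> S -> \bar R) :
  (forall x y, 0 <= a x y) ->
  \esum_(x in [set: T]) \esum_(y in [set: S]) a x y =
  \esum_(y in [set: S]) \esum_(x in [set: T]) a x y.
Proof.
move=> a0; rewrite !esum_esum//.
rewrite (reindex_esum ([set: S] `*`` fun=> [set: T]) _ (fun p => (p.2, p.1)))//.
split=> // [[x y] [x' y'] _ _ [-> ->]//|[x y] _].
by exists (y, x).
Qed.

End esum_extra.

Lemma normc_ge0 (R : realType) (z : R[i]) : 0 <= normc z.
Proof. by case: z => a b; exact: sqrtr_ge0. Qed.

Lemma normcE (R : realType) (z : R[i]) : `|z| = (normc z)%:C.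
Proof. by case: z => a b; rewrite normc_def. Qed.

Lemma normc_sum_le (R : realType) (T : Type) (r : seq T) (h : T -> R[i]) :
  normc (\sum_(x <- r) h x) <= \sum_(x <- r) normc (h x).
Proof.
elim/big_rec2 : _ => [|x a b _ ab]; first by rewrite normc0.
by rewrite (le_trans (le_normcD _ _))// lerD2l.
Qed.

Lemma normc_unord_sum (R : realType) (T : choiceType) (h : T -> R[i]^o) :
  ((normc (summability.sum h : R[i]))%:E
    <= \esum_(x in [set: T]) (normc (h x))%:E)%E.
Proof.
set M := (X in (_ <= X)%E).
have FF := @summability.totally_filter T.
have M0 : (0 <= M)%E by apply: esum_ge0 => x _; rewrite lee_fin normc_ge0.
have [Moo|Moo] := eqVneq M +oo%E; first by rewrite Moo leey.
have Mfin : M \is a fin_num by rewrite ge0_fin_numE// ltey.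
rewrite -(fineK Mfin) lee_fin /summability.sum.
have [cvh|dvh] := pselect (cvg (summability.partial_sum h @ summability.totally)); last first.
  by rewrite dvgP// normc0 fine_ge0.
set l := lim _; rewrite leNgt; apply/negP => Ml.
have e0 : (0 : R[i]) < (normc l - fine M)%:C by rewrite ltcR subr_gt0.
move/cvgrPdist_lt : cvh => /(_ _ e0) /filter_ex[A].
rewrite -/l normcE ltcR => lA.
have : normc (summability.partial_sum h A) <= fine M.
  rewrite /summability.partial_sum -(big_seq_fsetE _ A xpredT h).
  rewrite (le_trans (normc_sum_le _ _))// -lee_fin fineK// -sumEFin.
  apply: esum_ge; exists [set` A] => //.
  by rewrite fsbig_finite// set_fsetK.
move=> SA; have := le_lt_trans (le_normcD (l - summability.partial_sum h A)
  (summability.partial_sum h A)) (ltr_leD lA SA).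
by rewrite !subrK ltxx.
Qed.

Section weighted_l1.
Variables (R : realType) (G : groupType) (w : weight R G).
Local Notation C := (R[i]^o).

Definition wsum (g : G -> C) : \bar R :=
  (\esum_(x in [set: G]) (normc (g x) * w x)%:E)%E.

Definition in_l1 : {pred G -> C} := [pred g | (wsum g < +oo)%E].

Record l1 := L1 { l1_fun :> G -> C; _ : l1_fun \in in_l1 }.

HB.instance Definition _ := [isSub for l1_fun].
HB.instance Definition _ := [Choice of l1 by <:].

Let w0 x : 0 <= w x. Proof. exact/ltW/wt_gt0. Qed.

Let t0 (g : G -> C) x : (0 <= (normc (g x) * w x)%:E)%E.
Proof. by rewrite lee_fin mulr_ge0// normc_ge0. Qed.

Lemma wsum_ge0 g : (0 <= wsum g)%E.
Proof. by apply: esum_ge0 => x _; exact: t0. Qed.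

Lemma wsumD g h : (wsum (g + h)%R <= wsum g + wsum h)%E.
Proof.
rewrite -esumD//; apply: le_esum => x _; rewrite -EFinD lee_fin -mulrDl.
by rewrite ler_wpM2r// le_normcD.
Qed.

Lemma wsumZ_le (c : R[i]) g : (wsum (c *: g)%R <= (normc c)%:E * wsum g)%E.
Proof.
rewrite /wsum -esumZ ?normc_ge0//.
by apply: le_esum => x _; rewrite -EFinM lee_fin mulrA -normcM.
Qed.

Lemma l1_submod_closed : submod_closed in_l1.
Proof.
split=> [|c g h]; rewrite !inE.
  by rewrite /wsum esum1// => x _; rewrite normc0 mul0r.
move=> goo hoo; apply: le_lt_trans (wsumD _ _) _; apply: lte_add_pinfty => //.
apply: le_lt_trans (wsumZ_le _ _) _.
by rewrite lte_mul_pinfty// lee_fin normc_ge0.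
Qed.

HB.instance Definition _ := GRing.isSubmodClosed.Build R[i] (G -> C) in_l1
  l1_submod_closed.
HB.instance Definition _ := [SubChoice_isSubLmodule of l1 by <:].

Lemma l1_fin (g : l1) : wsum g \is a fin_num.
Proof. by rewrite ge0_fin_numE ?wsum_ge0//; exact: (valP g). Qed.

Definition l1_norm (g : l1) : R[i] := (fine (wsum g))%:C.

Lemma l1_normD g h : l1_norm (g + h) <= l1_norm g + l1_norm h.
Proof.
rewrite -rmorphD lecR -fineD ?l1_fin// fine_le ?fin_numD ?l1_fin//.
exact: wsumD.
Qed.

Let l1_normZ_le (c : R[i]) g : l1_norm (c *: g) <= `|c| * l1_norm g.
Proof.
rewrite normcE -rmorphM lecR -[X in X * _]/(fine (normc c)%:E) -fineM ?l1_fin//.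
by rewrite fine_le ?fin_numM ?l1_fin//; exact: wsumZ_le.
Qed.

Lemma l1_norm_eq0 g : l1_norm g = 0 -> g = 0.
Proof.
move=> /complexI g0; apply/val_inj/funext => x.
have wg0 : wsum g = 0%E by rewrite -(fineK (l1_fin g)) g0.
apply: eq0_normc; apply/eqP; rewrite eq_le normc_ge0 andbT.
have : ((normc (g x) * w x)%:E <= wsum g)%E.
  by apply: esum_ge; exists [set x] => //; rewrite fsbig_set1.
by rewrite wg0 lee_fin pmulr_lle0// wt_gt0.
Qed.

Lemma l1_normZ (c : R[i]) g : l1_norm (c *: g) = `|c| * l1_norm g.
Proof.
apply/eqP; rewrite eq_le l1_normZ_le/=.
have [->|c0] := eqVneq c 0.
  by rewrite normr0 mul0r lecR fine_ge0// wsum_ge0.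
rewrite -ler_pdivlMl ?normr_gt0// -normfV.
by apply: le_trans (l1_normZ_le _ _); rewrite scalerA mulVf// scale1r.
Qed.

HB.instance Definition _ :=
  Lmodule_isNormed.Build R[i] l1 l1_normD l1_normZ l1_norm_eq0.

(* [summability.sum] is the limit of the finite partial sums; the series is
   absolutely convergent for [f] and [g] in l1 because
   |f y| |g (y^-1 x)| w x <= (|f y| w y) (|g (y^-1 x)| w (y^-1 x)). *)
Definition conv_fun (f g : G -> C) (x : G) : C :=
  summability.sum (fun y : G => f y * g (y^-1 * x)%g : C).

Lemma conv_in_l1 (f g : l1) : conv_fun f g \in in_l1.
Proof.
rewrite inE.
pose u y := normc (f y) * w y; pose v y := normc (g y) * w y.
apply: (@le_lt_trans _ _ (\esum_(x in [set: G]) \esum_(y in [set: G])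
    (u y * v (y^-1 * x)%g)%:E)%E).
  apply: le_esum => x _.
  rewrite mulrC EFinM.
  apply: (@le_trans _ _ ((w x)%:E * \esum_(y in [set: G])
      (normc (f y * g (y^-1 * x)%g : R[i]))%:E)%E).
    by rewrite lee_wpmul2l ?lee_fin//; exact: normc_unord_sum.
  rewrite -esumZ// => [|y]; last by rewrite lee_fin normc_ge0.
  apply: le_esum => y _; rewrite -EFinM lee_fin normcM /u /v.
  have := wtM w y (y^-1 * x)%g; rewrite mulVKg => wxy.
  rewrite mulrACA mulrC ler_wpM2l// mulr_ge0 ?normc_ge0//.
rewrite exchange_esum; last by move=> x y; rewrite lee_fin !mulr_ge0 ?normc_ge0.
apply: (@le_lt_trans _ _ (\esum_(y in [set: G]) ((fine (wsum g))%:E * (u y)%:E))%E).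
  apply: le_esum => y _; rewrite muleC fineK ?l1_fin//.
  rewrite (_ : wsum g = \esum_(x in [set: G]) (v (y^-1 * x)%g)%:E)%E; last first.
    apply: reindex_esum; split=> // [a b _ _|z _]; first exact: mulgI.
    by exists (y * z)%g => //; rewrite mulKg.
  rewrite -esumZ ?mulr_ge0 ?normc_ge0// => x.
  by rewrite lee_fin mulr_ge0 ?normc_ge0.
rewrite esumZ ?fine_ge0 ?wsum_ge0//; last by move=> y; exact: t0.
by rewrite lte_mul_pinfty// ?fineK ?l1_fin ?wsum_ge0//; exact: (valP f).
Qed.

Definition l1_conv (f g : l1) : l1 := L1 (conv_in_l1 f g).

End weighted_l1.

Section injective_tensor.
Variables (R : realType) (A B : normedModType R[i]).
Local Notation C := (R[i]^o).

(* Closed unit ball of the topological dual of [V]. *)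
Definition dual_ball (V : normedModType R[i]) : Type :=
  {phi : {linear V -> C} | forall v, `|phi v| <= `|v|}.

(* By Hahn-Banach, a (x) b |-> ((phi, psi) |-> phi a * psi b) identifies the
   algebraic tensor product with the span [alg_tensor] of the functions
   [tens_fun a b], and the sup norm of sum_i tens_fun (a i) (b i) is its
   injective norm
     sup { |sum_i phi (a i) * psi (b i)| : |phi| <= 1, |psi| <= 1 }.
   The injective tensor product, i.e. the completion for this norm, is thus the
   closure [itensor] of [alg_tensor] in the Banach space of bounded functions on
   dual_ball A * dual_ball B. *)
Local Notation bifun := (dual_ball A * dual_ball B -> C).

Definition tens_fun (a : A) (b : B) : bifun :=
  fun p => sval p.1 a * sval p.2 b.

Definition alg_tensor : set bifun :=
  [set u | exists n (a : 'I_n -> A) (b : 'I_n -> B),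
     u = \sum_(i < n) tens_fun (a i) (b i)].

Definition in_itensor : {pred bifun} := [pred u | `[<
  forall e : R, 0 < e -> exists2 t, alg_tensor t &
    forall p, normc (u p - t p) <= e >]].

Record itensor := ITensor { itensor_fun :> bifun; _ : itensor_fun \in in_itensor }.

HB.instance Definition _ := [isSub for itensor_fun].
HB.instance Definition _ := [Choice of itensor by <:].

Lemma alg_tensorZD (c : R[i]) u v :
  alg_tensor u -> alg_tensor v -> alg_tensor (c *: u + v).
Proof.
move=> [m [a [b ->]]] [n [a' [b' ->]]]; exists (m + n)%N.
exists (fun i => match fintype.split i with inl j => c *: a j | inr j => a' j end).
exists (fun i => match fintype.split i with inl j => b j | inr j => b' j end).
rewrite big_split_ord/= scaler_sumr; congr (_ + _); apply: eq_bigr => i _.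
  rewrite (unsplitK (inl i)); apply/funext => p; rewrite /tens_fun linearZ/=.
  by rewrite -scalerAl.
by rewrite (unsplitK (inr i)).
Qed.

Lemma itensor_submod_closed : submod_closed in_itensor.
Proof.
split=> [|c u v].
  apply/asboolP => e e0; exists 0.
    exists 0%N, (fun=> 0), (fun=> 0); by rewrite big_ord0.
  by move=> p; rewrite subrr normc0 ltW.
move=> /asboolP uT /asboolP vT; apply/asboolP => e e0.
have c0 : 0 < normc c + 1 by rewrite ltr_wpDl// normc_ge0.
have [s sT us] := uT (e / 2 / (normc c + 1)) ltac:(by rewrite !divr_gt0).
have [t tT vt] := vT (e / 2) ltac:(by rewrite divr_gt0).
exists (c *: s + t) => [|p]; first exact: alg_tensorZD.
rewrite (_ : _ - _ = c * (u p - s p) + (v p - t p)); last first.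
  by rewrite mulrBr -addrACA opprD addrACA.
rewrite (le_trans (le_normcD _ _))// [leRHS](splitr e) lerD// normcM.
apply: (@le_trans _ _ ((normc c + 1) * normc (u p - s p))).
  by rewrite ler_wpM2r ?normc_ge0// lerDl.
by rewrite mulrC -ler_pdivlMr.
Qed.

HB.instance Definition _ := GRing.isSubmodClosed.Build R[i] bifun in_itensor
  itensor_submod_closed.
HB.instance Definition _ := [SubChoice_isSubLmodule of itensor by <:].

Lemma dual_ball_le (V : normedModType R[i]) (phi : dual_ball V) v :
  normc (sval phi v) <= normc `|v|.
Proof. by rewrite -lecR -!normcE normr_id; exact: (svalP phi). Qed.

Lemma itensor_bounded (u : itensor) :
  exists M : R, forall p, normc (u p) <= M.
Proof.
have /asboolP/(_ 1 ltr01)[_ [n [a [b ->]]] ut] := valP u.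
exists (1 + \sum_(i < n) normc `|a i| * normc `|b i|) => p.
rewrite -[u p](subrK ((\sum_(i < n) tens_fun (a i) (b i)) p)).
rewrite (le_trans (le_normcD _ _))// lerD ?ut// fct_sumE.
rewrite (le_trans (normc_sum_le _ _))// ler_sum// => i _.
by rewrite normcM ler_pM ?normc_ge0// dual_ball_le.
Qed.

Definition itensor_sup (u : itensor) : R :=
  sup [set normc (u p) | p in [set: dual_ball A * dual_ball B]].

Definition itensor_norm (u : itensor) : R[i] := (itensor_sup u)%:C.

Lemma dual_ball0 (V : normedModType R[i]) : dual_ball V.
Proof. by exists (\0%R : {linear V -> C}) => v; rewrite normr0. Qed.

Lemma le_itensor_sup (u : itensor) p : normc (u p) <= itensor_sup u.
Proof.
apply: sup_ubound; last by exists p.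
by have [M uM] := itensor_bounded u; exists M => _ [q _ <-].
Qed.

Lemma itensor_sup_le (u : itensor) M :
  (forall p, normc (u p) <= M) -> itensor_sup u <= M.
Proof.
move=> uM; apply: ge_sup => [|_ [p _ <-]//].
by exists (normc (u (dual_ball0 A, dual_ball0 B))), (dual_ball0 A, dual_ball0 B).
Qed.

Lemma itensor_sup_ge0 (u : itensor) : 0 <= itensor_sup u.
Proof.
apply: le_trans (le_itensor_sup u (dual_ball0 A, dual_ball0 B)).
exact: normc_ge0.
Qed.

Lemma itensor_normD u v :
  itensor_norm (u + v) <= itensor_norm u + itensor_norm v.
Proof.
rewrite -rmorphD lecR; apply: itensor_sup_le => p.
by rewrite (le_trans (le_normcD _ _))// lerD// le_itensor_sup.
Qed.

Let itensor_normZ_le (c : R[i]) u :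
  itensor_norm (c *: u) <= `|c| * itensor_norm u.
Proof.
rewrite normcE -rmorphM lecR; apply: itensor_sup_le => p.
by rewrite [(c *: u) p]/(c * u p) normcM ler_wpM2l ?normc_ge0// le_itensor_sup.
Qed.

Lemma itensor_normZ (c : R[i]) u : itensor_norm (c *: u) = `|c| * itensor_norm u.
Proof.
apply/eqP; rewrite eq_le itensor_normZ_le/=.
have [->|c0] := eqVneq c 0.
  by rewrite normr0 mul0r lecR itensor_sup_ge0.
rewrite -ler_pdivlMl ?normr_gt0// -normfV.
by apply: le_trans (itensor_normZ_le _ _); rewrite scalerA mulVf// scale1r.
Qed.

Lemma itensor_norm_eq0 u : itensor_norm u = 0 -> u = 0.
Proof.
move=> /complexI u0; apply/val_inj/funext => p; apply: eq0_normc.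
by apply/eqP; rewrite eq_le normc_ge0 andbT -u0 le_itensor_sup.
Qed.

HB.instance Definition _ := Lmodule_isNormed.Build R[i] itensor
  itensor_normD itensor_normZ itensor_norm_eq0.

Lemma tens_in (a : A) (b : B) : tens_fun a b \in in_itensor.
Proof.
apply/asboolP => e e0; exists (tens_fun a b).
  by exists 1%N, (fun=> a), (fun=> b); rewrite big_ord1.
by move=> p; rewrite subrr normc0 ltW.
Qed.

Definition tens (a : A) (b : B) : itensor := ITensor (tens_in a b).

End injective_tensor.

(* [mul] is the multiplication of the algebra [A]; boundedness of the linear
   map T : itensor A A -> A is with respect to the injective norm. *)
Definition injective_algebra (R : realType) (A : normedModType R[i])
    (mul : A -> A -> A) : Prop :=
  exists T : {linear itensor A A -> A},
    (exists M : R, forall u, `|T u| <= M%:C * `|u|) /\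
    (forall a b, T (tens a b) = mul a b).

(* Main.v *)
(** Positive words of length [n] in the two generators give [N = 2 ^ n] elements
    [x] of [F2] whose pairwise products [x y] are all distinct. With [H] the
    [N] x [N] Walsh-Hadamard matrix, put
    [u = sum_(x, y) H x y (delta_x (x) delta_y)]. Multiplication maps [u]
    to [sum_(x, y) H x y delta_(x y)], of norm at least [N ^ 2]. Since
    [N ^ (-1/2) H] is orthogonal, Cauchy-Schwarz bounds the injective norm of
    [u] by [N ^ (3/2) D ^ 2], where [D] bounds the weight on these words. If multiplication were bounded by [M] for the injective
    norm, then [2 ^ n <= M ^ 2 D ^ 4], which is impossible because [D] grows
    polynomially in [n]. *)
Require Import Defs.
From HB Require Import structures.
From mathcomp Require Import all_boot all_order all_algebra.
From mathcomp Require Import all_classical all_reals all_analysis.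
From mathcomp Require Import finmap complex ring lra.
From mathcomp Require summability.

Set Implicit Arguments.
Unset Strict Implicit.
Unset Printing Implicit Defensive.

Import Order.TTheory GRing.Theory Num.Theory.
Import numFieldNormedType.Exports ComplexField.Normc.
Local Open Scope classical_set_scope.
Local Open Scope complex_scope.
Local Open Scope ring_scope.

(** * Cauchy-Schwarz and the Walsh-Hadamard matrix *)

Lemma sqr_sum_le (C : numDomainType) (I : finType) (a : I -> C) :
  (forall i, a i \is Num.real) ->
  (\sum_i a i) ^+ 2 <= #|I|%:R * \sum_i a i ^+ 2.
Proof.
move=> a_real; rewrite -subr_ge0 -(pmulrn_lge0 _ (ltn0Sn 1)).
suff -> : (#|I|%:R * \sum_i a i ^+ 2 - (\sum_i a i) ^+ 2) *+ 2 =
    \sum_i \sum_j (a i - a j) ^+ 2.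
  by apply: sumr_ge0 => i _; apply: sumr_ge0 => j _;
    rewrite -realEsqr rpredB.
have row i : \sum_j (a i - a j) ^+ 2 =
    #|I|%:R * a i ^+ 2 - 2 * (\sum_j a j) * a i + \sum_j a j ^+ 2.
  under eq_bigr do rewrite sqrrB.
  rewrite big_split sumrB sumr_const sumrMnl -mulr_sumr /=.
  by rewrite -[_ ^+ 2 *+ _]mulr_natl; ring.
rewrite (eq_bigr _ (fun i _ => row i)) big_split sumrB sumr_const.
rewrite -!mulr_sumr /=.
by rewrite -[(\sum_i _ ^+ 2) *+ _]mulr_natl; ring.
Qed.

Section walsh.
Variable n : nat.
Local Notation cube := {ffun 'I_n -> bool}.

(** The character table of [(Z/2)^n], or [n]-fold tensor power of the 2 x 2 Hadamard matrix;
    indexing by the cube makes sums over [x] factor by coordinates. *)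
Definition walsh (C : numDomainType) (x y : cube) : C :=
  \prod_i (-1) ^+ (x i && y i).

Lemma norm_walsh (C : numDomainType) x y : `|walsh C x y| = 1.
Proof. by rewrite normr_prod big1 // => i _; rewrite normrX normrN1 expr1n. Qed.

(** The sum is a product over [i] of sums over one bit; a factor is 2 where [y] and [z] agree and 0
    where they differ. *)
Lemma walsh_orthogonal (C : numDomainType) y z :
  \sum_x walsh C x y * walsh C x z = #|{: cube}|%:R * (y == z)%:R.
Proof.
under eq_bigr do rewrite -big_split.
rewrite -(bigA_distr_bigA (fun i b => (-1) ^+ (b && y i) * (-1) ^+ (b && z i))).
rewrite card_ffun card_bool card_ord natrX.
have [<-|yz] := eqVneq y z.
  rewrite mulr1 -[X in _ ^+ X](card_ord n) -prodr_const; apply: eq_bigr => i _.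
  by rewrite big_bool /= mul1r -expr2 sqrr_sign.
have [i yzi] : exists i, y i != z i.
  by apply/existsP; rewrite -negb_forall; apply: contraNN yz => /forallP yz;
    apply/eqP/ffunP => i; exact/eqP.
rewrite mulr0 (bigD1 i) //= big_bool /= -signr_addb.
by case: (y i) (z i) yzi => [] [] //= _; rewrite expr0 mulr1 expr1 addNr mul0r.
Qed.

(** Expanding the squares gives a double sum over [y] and [z], whose off-diagonal terms vanish by
    orthogonality. *)
Lemma walsh_parseval (C : numClosedFieldType) (g : cube -> C) :
  \sum_x `|\sum_y walsh C x y * g y| ^+ 2 =
  #|{: cube}|%:R * \sum_y `|g y| ^+ 2.
Proof.
have conj_walsh x y : (walsh C x y)^* = walsh C x y.
  by apply/CrealP; apply: rpred_prod => i _; rewrite rpredX // rpredN rpred1.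
transitivity (\sum_y \sum_z (g y * (g z)^* * \sum_x walsh C x y * walsh C x z)).
  under eq_bigr do rewrite normCK rmorph_sum big_distrlr.
  rewrite exchange_big; apply: eq_bigr => y _.
  rewrite exchange_big; apply: eq_bigr => z _ /=.
  rewrite mulr_sumr; apply: eq_bigr => x _.
  by rewrite rmorphM /= conj_walsh; ring.
rewrite mulr_sumr; apply: eq_bigr => y _.
rewrite (bigD1 y) //= [X in _ + X]big1 => [|z zy]; rewrite walsh_orthogonal.
  by rewrite eqxx addr0 mulr1 normCK mulrC.
by rewrite eq_sym (negPf zy) !mulr0.
Qed.

(** The triangle inequality alone would give [N ^+ 4]; the factor [N] saved here yields the final
    contradiction. Both sides are squared to avoid roots of [N]. *)
Lemma walsh_bilinear_le (C : numClosedFieldType) (f g : cube -> C) (D : C) :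
  (forall x, `|f x| <= D) -> (forall y, `|g y| <= D) ->
  `|\sum_x \sum_y walsh C x y * (f x * g y)| ^+ 2 <=
  #|{: cube}|%:R ^+ 3 * D ^+ 4.
Proof.
set N : C := #|_|%:R => fD gD.
have D_ge0 : 0 <= D by apply: le_trans (fD [ffun=> false]).
have N_ge0 : 0 <= N by exact: ler0n.
pose h x := \sum_y walsh C x y * g y.
have -> : \sum_x \sum_y walsh C x y * (f x * g y) = \sum_x f x * h x.
  apply: eq_bigr => x _; rewrite mulr_sumr.
  by apply: eq_bigr => y _; rewrite mulrCA.
have fh_le : `|\sum_x f x * h x| <= D * \sum_x `|h x|.
  rewrite mulr_sumr; apply: le_trans (ler_norm_sum _ _ _) _.
  by apply: ler_sum => x _; rewrite normrM ler_wpM2r.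
have g2_le : \sum_y `|g y| ^+ 2 <= N * D ^+ 2.
  rewrite mulr_natl -sumr_const; apply: ler_sum => y _.
  by rewrite lerXn2r ?nnegrE ?mulr_ge0 ?sumr_ge0.
apply: le_trans (_ : (D * \sum_x `|h x|) ^+ 2 <= _).
  by rewrite lerXn2r ?nnegrE ?mulr_ge0 ?sumr_ge0.
(* From the outside in, the factors [N] are due to Cauchy-Schwarz, Parseval and [g2_le]. *)
have -> : N ^+ 3 * D ^+ 4 = D ^+ 2 * (N * (N * (N * D ^+ 2))) by ring.
rewrite exprMn ler_wpM2l ?exprn_ge0 //.
apply: le_trans (sqr_sum_le _) _ => [x|]; first exact: normr_real.
by rewrite ler_wpM2l // walsh_parseval ler_wpM2l.
Qed.

End walsh.

(** * Point masses in the weighted algebra *)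

Lemma unord_sum_single (K : numFieldType) (V : normedModType K)
    (I : choiceType) (h : I -> V) (y : I) :
  (forall z, z != y -> h z = 0) -> summability.sum h = h y.
Proof.
move=> h0; have TF := @summability.totally_filter I.
apply: cvg_lim; first exact: norm_hausdorff.
(* Every finite set containing [y] has partial sum [h y], so the net is eventually constant. *)
apply: cvg_near_cst; exists [fset y]%fset => // A /= /fsubsetP yA.
rewrite /summability.partial_sum -(big_seq_fsetE _ A xpredT h) /=.
by rewrite (bigD1_seq y) ?fset_uniq ?yA ?inE //= big1 ?addr0.
Qed.

Section delta.
Variables (R : realType) (G : groupType) (w : weight R G).

Definition delta_fun (x : G) : G -> R[i]^o := fun y => (y == x)%:R.

Lemma wsum_delta x : wsum w (delta_fun x) = (w x)%:E.
Proof.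
rewrite /wsum.
transitivity (\esum_(y in [set x]) (w y)%:E)%E; last first.
  by rewrite esum_set1 // lee_fin ltW // wt_gt0.
rewrite esum_mkcond; apply: eq_esum => y _; rewrite /delta_fun in_set1.
by case: eqP => _; rewrite ?normc1 ?normc0 ?mul1r ?mul0r.
Qed.

Lemma delta_in_l1 x : delta_fun x \in in_l1 w.
Proof. by rewrite inE wsum_delta ltey. Qed.

Definition delta x : l1 w := L1 (delta_in_l1 x).

Lemma norm_delta x : `|delta x| = (w x)%:C.
Proof. by rewrite -[LHS]/(l1_norm (delta x)) /l1_norm wsum_delta. Qed.

Lemma l1_conv_delta x y : l1_conv (delta x) (delta y) = delta (x * y)%g.
Proof.
apply/val_inj/funext => z /=; rewrite /conv_fun /delta_fun.
rewrite (@unord_sum_single _ _ _ _ x) => [|t tx].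
  rewrite eqxx mul1r (_ : (_ == y) = (z == (x * y)%g)) //.
  by rewrite -(inj_eq (mulgI x)) mulVKg.
by rewrite (negPf tx) mul0r.
Qed.

End delta.

(** * The Walsh tensor and its image under multiplication *)

Section walsh_tensor.
Variables (R : realType) (G : groupType) (w : weight R G).
Variable n : nat.
Local Notation cube := {ffun 'I_n -> bool}.
Local Notation N := (#|{: cube}|).
Variable e : cube -> G.

Definition walsh_tensor : itensor (l1 w) (l1 w) :=
  \sum_x \sum_y walsh R[i] x y *: tens (delta w (e x)) (delta w (e y)).

Lemma walsh_tensorE p : walsh_tensor p =
  \sum_x \sum_y walsh R[i] x y *
    (sval p.1 (delta w (e x)) * sval p.2 (delta w (e y))).
Proof.
pose ev (u : itensor (l1 w) (l1 w)) : R[i] := u p.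
have evD : {morph ev : u v / u + v >-> u + v} by [].
have ev0 : ev 0 = 0 by [].
rewrite -[LHS]/(ev _) (big_morph ev evD ev0); apply: eq_bigr => x _.
by rewrite (big_morph ev evD ev0).
Qed.

(** Functionals in the dual ball take values of modulus at most [D] on the point masses, so the
    bilinear bound holds uniformly in [p]. *)
Lemma itensor_sup_walsh (D : R) : (forall x, w (e x) <= D) ->
  itensor_sup walsh_tensor ^+ 2 <= N%:R ^+ 3 * D ^+ 4.
Proof.
move=> wD.
have D_ge0 : 0 <= D by apply: le_trans (ltW (wt_gt0 w _)) (wD [ffun=> false]).
rewrite -[leRHS]sqr_sqrtr ?mulr_ge0 ?exprn_ge0 //.
rewrite lerXn2r ?nnegrE ?itensor_sup_ge0 ?sqrtr_ge0 //.
apply: itensor_sup_le => p.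
rewrite -[leLHS](ger0_norm (normc_ge0 _)) -sqrtr_sqr ler_wsqrtr //.
rewrite -lecR rmorphXn /= -Defs.normcE walsh_tensorE.
have dualD (phi : dual_ball (l1 w)) x : `|sval phi (delta w (e x))| <= D%:C.
  by apply: le_trans (svalP phi _) _; rewrite norm_delta lecR.
apply: le_trans (walsh_bilinear_le (dualD p.1) (dualD p.2)) _.
by rewrite rmorphM !rmorphXn /= rmorph_nat.
Qed.

(** Distinct products rule out cancellation: the image has modulus 1 at [N ^ 2] points, each of
    weight at least 1. *)
Lemma norm_conv_walsh_tensor (T : {linear itensor (l1 w) (l1 w) -> l1 w}) :
  (forall a b, T (tens a b) = l1_conv a b) ->
  injective (fun p => e p.1 * e p.2)%g ->
  (forall z, 1 <= w z) ->
  (N%:R ^+ 2)%:C <= `|T walsh_tensor|.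
Proof.
move=> Tmul e_inj w_ge1.
have TE : T walsh_tensor =
    \sum_p walsh R[i] p.1 p.2 *: delta w (e p.1 * e p.2)%g.
  rewrite linear_sum.
  rewrite -(pair_bigA _ (fun x y => walsh R[i] x y *: delta w (e x * e y)%g)).
  apply: eq_bigr => x _; rewrite linear_sum; apply: eq_bigr => y _.
  by rewrite linearZ /= Tmul l1_conv_delta.
have TwE q : T walsh_tensor (e q.1 * e q.2)%g = walsh R[i] q.1 q.2.
  rewrite TE; pose ev (g : l1 w) : R[i] := g (e q.1 * e q.2)%g.
  have evD : {morph ev : u v / u + v >-> u + v} by [].
  have ev0 : ev 0 = 0 by [].
  have evZ c z : ev (c *: delta w z) = c * (e q.1 * e q.2 == z)%g%:R by [].
  rewrite -[LHS]/(ev _) (big_morph ev evD ev0).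
  rewrite (eq_bigr _ (fun p _ => evZ _ _)) (bigD1 q) //= big1 => [|p pq].
    by rewrite eqxx mulr1 addr0.
  by rewrite (inj_eq e_inj) eq_sym (negPf pq) mulr0.
rewrite -[leRHS]/(l1_norm (T walsh_tensor)) /l1_norm lecR.
rewrite -lee_fin fineK ?l1_fin //.
apply: esum_ge; exists [set` [seq (e p.1 * e p.2)%g | p : cube * cube]].
  by split => //; exact: finite_seq.
rewrite -fsbig_seq; last by rewrite (map_inj_uniq e_inj) enum_uniq.
rewrite big_map big_enum /= sumEFin lee_fin expr2 -natrM -card_prod.
rewrite -sum1_card natr_sum.
apply: ler_sum => p _; rewrite TwE.
have -> : normc (walsh R[i] p.1 p.2) = 1.
  by apply: complexI; rewrite -Defs.normcE norm_walsh.
by rewrite mul1r.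
Qed.

(** Squaring the two norm estimates gives [N ^ 4 <= M ^ 2 * N ^ 3 * D ^ 4], and [N ^ 3] cancels. *)
Lemma injective_walsh_bound (D : R) (T : {linear itensor (l1 w) (l1 w) -> l1 w})
    (M : R) :
  (forall u, `|T u| <= M%:C * `|u|) ->
  (forall a b, T (tens a b) = l1_conv a b) ->
  injective (fun p => e p.1 * e p.2)%g ->
  (forall z, 1 <= w z) -> (forall x, w (e x) <= D) ->
  2 ^+ n <= M ^+ 2 * D ^+ 4.
Proof.
move=> T_le Tmul e_inj w_ge1 wD.
have N_gt0 : 0 < (N%:R : R).
  by rewrite ltr0n; apply/card_gt0P; exists [ffun=> false].
have NE : 2 ^+ n = N%:R :> R by rewrite card_ffun card_bool card_ord natrX.
have /le_trans/(_ (T_le _)) := norm_conv_walsh_tensor Tmul e_inj w_ge1.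
rewrite -[X in _ * X]/((itensor_sup _)%:C) -rmorphM lecR => N2_le.
have : (N%:R ^+ 2) ^+ 2 <= M ^+ 2 * (N%:R ^+ 3 * D ^+ 4).
  apply: le_trans (_ : (M * itensor_sup walsh_tensor) ^+ 2 <= _).
    (* Squaring is monotone here: the product with [M] dominates [N ^+ 2], hence is nonnegative. *)
    by rewrite lerXn2r ?nnegrE ?exprn_ge0 // (le_trans _ N2_le) ?exprn_ge0.
  by rewrite exprMn ler_wpM2l ?sqr_ge0 // itensor_sup_walsh.
rewrite NE (_ : (_ ^+ 2) ^+ 2 = N%:R ^+ 3 * N%:R); last by ring.
by rewrite mulrCA ler_pM2l // exprn_gt0.
Qed.

End walsh_tensor.

(** * Positive words in a free group *)

Section positive_words.
Variable I : choiceType.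

Lemma positive_reduced (s : seq I) : reduced [seq (i, false) | i <- s].
Proof.
rewrite /reduced; case: s => //= i s; elim: s i => //= j s IHs i.
by rewrite IHs andbT; apply/eqP => -[].
Qed.

Definition positive_word (s : seq I) : free_group I :=
  FreeWord (positive_reduced s).

Lemma positive_word_inj : injective positive_word.
Proof. by move=> s t /(congr1 val) /inj_map; apply=> i j []. Qed.

(** Two positive letters are never mutually inverse, so [push] never cancels. *)
Lemma positive_word_cat s t :
  positive_word (s ++ t) = (positive_word s * positive_word t)%g.
Proof.
apply/val_inj; rewrite /= map_cat; elim: s => //= i s <-.
by case: s => [|j s] /=; [case: t => //= j t|]; rewrite xpair_eqE andbF.
Qed.

End positive_words.

(** A free generator may have length above 1 for an arbitrary [F]; subadditivity of [tau] charges
    each letter the maximum. *)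
Lemma tau_positive_word_le (I : finType) (F : symGenSet (free_group I))
    (s : seq I) :
  (tau F (positive_word s)
    <= size s * \max_i tau F (positive_word [:: i]))%N.
Proof.
elim: s => [|i s IHs].
  by rewrite (_ : positive_word _ = 1%g) ?tau1 //; exact: val_inj.
rewrite -cat1s positive_word_cat mulSn; apply: leq_trans (tauM _ _ _) _.
by rewrite leq_add // (leq_bigmax i).
Qed.

(** * Growth comparison and conclusion *)

Lemma exp_outgrows_poly (R : archiRealFieldType) (A a : R) (k : nat) :
  0 <= A -> 0 <= a -> exists n, A * (1 + a * n%:R) ^+ k < 2 ^+ n.
Proof.
move=> A_ge0 a_ge0; pose b := 1 + a * k.+1%:R.
have b_ge0 : 0 <= b by rewrite addr_ge0 // mulr_ge0.
(* With [n] equal to [m * k.+1], [2 ^+ n] is at least [m.+1 ^ k.+1]: one factor [m.+1] absorbs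
   [A * b ^+ k], the other [k] absorb the growth in [n]. *)
pose m := Num.bound (A * b ^+ k); exists (m * k.+1)%N.
have m_gt : A * b ^+ k < m.+1%:R.
  apply: lt_trans (archi_boundP _) _; last by rewrite ltr_nat.
  by rewrite mulr_ge0 // exprn_ge0.
apply: le_lt_trans (_ : A * (b * m.+1%:R) ^+ k < _).
  rewrite ler_wpM2l // lerXn2r ?nnegrE ?addr_ge0 ?mulr_ge0 //.
  rewrite natrM /b -[m.+1]add1n natrD; have : 0 <= (m%:R : R) by [].
  have : 0 <= a * (k.+1%:R : R) by rewrite mulr_ge0.
  by nra.
rewrite exprMn mulrA; apply: lt_le_trans (_ : m.+1%:R ^+ k.+1 <= _).
  by rewrite exprS ltr_pM2r // exprn_gt0.
by rewrite exprM lerXn2r ?nnegrE ?exprn_ge0 // -natrX ler_nat ltn_expl.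
Qed.

Theorem theorem5p1 (R : realType) (F : symGenSet F2) (beta : R)
    (beta_gt0 : 0 < beta) :
  ~ injective_algebra (@l1_conv R F2 (omega F (ltW beta_gt0))).
Proof.
move=> [T [[M T_le] Tmul]].
pose c := (\max_i tau F (positive_word [:: i]))%N.
(* A natural exponent above [4 * beta], since the weight bound enters to the fourth power. *)
pose k := Num.bound (4 * beta).
have [n] := exp_outgrows_poly k (sqr_ge0 M) (ler0n R c).
apply/negP; rewrite -leNgt.
pose s (x : {ffun 'I_n -> bool}) : seq 'I_2 :=
  [seq if x i then ord_max else ord0 | i <- enum 'I_n].
have size_s x : size (s x) = n by rewrite size_map size_enum_ord.
have s_inj : injective s.
  move=> x y /eq_in_map xy; apply/ffunP => i.
  by have := xy i (mem_enum _ i); case: (x i) (y i) => [] [].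
pose e x : F2 := positive_word (s x).
have e_inj : injective (fun p => e p.1 * e p.2)%g.
  move=> [x y] [x' y'] /=; rewrite -!positive_word_cat.
  move=> /positive_word_inj/eqP.
  (* Both factors have length [n], so the concatenation determines the pair. *)
  by rewrite eqseq_cat ?size_s // => /andP[/eqP/s_inj -> /eqP/s_inj ->].
pose b : R := 1 + c%:R * n%:R.
have b_ge1 : 1 <= b by rewrite lerDl mulr_ge0.
have we x : omega F (ltW beta_gt0) (e x) <= b `^ beta.
  rewrite ge0_ler_powR ?nnegrE ?(ltW beta_gt0) ?addr_ge0 ?mulr_ge0 // lerD2l.
  by rewrite -natrM ler_nat mulnC -(size_s x) tau_positive_word_le.
have w_ge1 z : 1 <= omega F (ltW beta_gt0) z.
  apply: le_trans (_ : 1 `^ beta <= _); first by rewrite powR1.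
  by rewrite ge0_ler_powR ?nnegrE ?(ltW beta_gt0) ?lerDl ?addr_ge0.
apply: le_trans (injective_walsh_bound T_le Tmul e_inj w_ge1 we) _.
rewrite ler_wpM2l ?sqr_ge0 // -powR_mulrn ?powR_ge0 // -powRrM mulrC.
rewrite -powR_mulrn ?(le_trans _ b_ge1) //.
(* As [1 <= b], the exponent [4 * beta] may be raised to [k]. *)
apply: ler_powR => //; apply/ltW/archi_boundP.
by rewrite mulr_ge0 // ltW.
Qed.
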